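(* Let $K$ be a field of characteristic $p>0$, let $n\ge1$, and let $F\in\mathrm{GA}_n(K)$ be Pascal finite. Then $$|F|=p^{\lceil\log_p\tau_K(F)\rceil}.$$ In particular the order of a Pascal finite automorphism is a power of $p$.
   Context: $K[X]=K[X_1,\dots,X_n]$. $\mathrm{GA}_n(K)$ is the group of polynomial automorphisms of affine $n$-space over $K$: an element is a tuple $F=(F_1,\dots,F_n)\in K[X]^n$ that has a two-sided inverse in $K[X]^n$ under the composition $(F\circ G)_i=F_i\circ G=F_i(G_1,\dots,G_n)$; the identity is $\mathrm{Id}=(X_1,\dots,X_n)$. $|F|$ denotes the order of $F$ in this group. For $F\in K[X]^n$ let $\sigma_F\colon K[X]\to K[X]$, $\sigma_F(P)=P\circ F=P(F_1,\dots,F_n)$, and $\Delta_F=\sigma_F-\mathrm{Id}$, i.e. $\Delta_F(P)=P\circ F-P$. For $g\in K[X]$ the Pascal depth of $g$ with respect to $F$ is $\tau_K^F(g)=\min\{m\ge1:\Delta_F^m(g)=0\}$, with value $\infty$ if no such $m$ exists. Set $\tau_K(F)=\max_{1\le i\le n}\tau_K^F(X_i)$ (the Pascal depth of $F$). $F$ is called Pascal finite if $\tau_K(F)<\infty$. *)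

(* Defs.v *)
From HB Require Import structures.
From mathcomp Require Import all_boot all_algebra.
From mathcomp Require Import boolp mpoly.

Set Implicit Arguments.
Unset Strict Implicit.
Unset Printing Implicit Defensive.

Import GRing.Theory.
Local Open Scope ring_scope.

(* Values in {0, 1, 2, ...} u {oo}, with None standing for oo. *)
Definition enat := option nat.

Definition emax (a b : enat) : enat :=
  if a is Some x then (if b is Some y then Some (maxn x y) else None) else None.

(* min {m >= 1 : P m}, which is oo when there is no such m. *)
Definition least_pos (P : pred nat) : enat :=
  match pselect (exists m, (0 < m)%N && P m) with
  | left exP => Some (ex_minn exP)
  | right _ => None
  end.

Lemma least_posP (P : pred nat) (m : nat) :
  least_pos P = Some m <->
  [/\ (0 < m)%N, P m & forall k, (0 < k)%N -> P k -> (m <= k)%N].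
Proof.
rewrite /least_pos; case: pselect => [exP | nexP]; last first.
  by split=> // -[m_gt0 Pm _]; case: nexP; exists m; rewrite m_gt0.
case: ex_minnP => k /andP[k_gt0 Pk] kmin; split=> [[<-] | [m_gt0 Pm mmin]].
  by split=> // j j_gt0 Pj; apply: kmin; rewrite j_gt0.
by congr Some; apply/eqP; rewrite eqn_leq mmin // kmin // m_gt0.
Qed.

Lemma least_pos_None (P : pred nat) :
  least_pos P = None <-> forall m, (0 < m)%N -> ~~ P m.
Proof.
rewrite /least_pos; case: pselect => [exP | nexP]; split=> //.
  move=> nP; case: (ex_minnP exP) => m /andP[m_gt0].
  by rewrite (negbTE (nP m m_gt0)).
by move=> _ m m_gt0; apply/negP => Pm; case: nexP; exists m; rewrite m_gt0.
Qed.

Definition group_order (G : groupType) (x : G) : enat :=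
  least_pos (fun m => (x ^+ m)%g == 1%g).

Section PolynomialMaps.
Variables (K : fieldType) (n : nat).

Definition polymap := n.-tuple {mpoly K[n]}.

Definition pm_id : polymap := [tuple 'X_i | i < n].

Definition pm_comp (F G : polymap) : polymap :=
  [tuple tnth F i \mPo G | i < n].

Definition pm_sigma (F : polymap) (P : {mpoly K[n]}) : {mpoly K[n]} := P \mPo F.

Definition pm_Delta (F : polymap) (P : {mpoly K[n]}) : {mpoly K[n]} :=
  pm_sigma F P - P.

Definition pascal_depth_at (F : polymap) (g : {mpoly K[n]}) : enat :=
  least_pos (fun m => iter m (pm_Delta F) g == 0).

Definition pascal_depth (F : polymap) : enat :=
  \big[emax/Some 0%N]_(i < n) pascal_depth_at F 'X_i.

Definition pascal_finite (F : polymap) : bool := pascal_depth F != None.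

Lemma pm_compA : associative pm_comp.
Proof.
move=> F G H; apply: eq_from_tnth => i; rewrite !tnth_mktuple.
rewrite [tnth F i]mpolyE (raddf_sum (comp_mpoly (pm_comp G H))).
rewrite (raddf_sum (comp_mpoly G)) (raddf_sum (comp_mpoly H)) /=.
apply: eq_bigr => m _.
rewrite !comp_mpolyZ !comp_mpolyX rmorph_prod /=; congr (_ *: _).
by apply: eq_bigr => j _; rewrite rmorphXn /= tnth_mktuple.
Qed.

Lemma pm_comp1 : right_id pm_id pm_comp.
Proof.
by move=> F; apply: eq_from_tnth => i; rewrite tnth_mktuple comp_mpoly_id.
Qed.

Lemma pm_1comp : left_id pm_id pm_comp.
Proof.
move=> F; apply: eq_from_tnth => i.
by rewrite !tnth_mktuple comp_mpolyXU -tnth_nth.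
Qed.

(* An automorphism carries its two-sided inverse along, which makes GA a       *)
(* choiceType; GA_inj and GA_intro show that its elements are exactly the      *)
(* invertible polynomial maps.                                                 *)
Record GA := MkGA {
  GA_pair : polymap * polymap;
  _ : (pm_comp GA_pair.1 GA_pair.2 == pm_id)
      && (pm_comp GA_pair.2 GA_pair.1 == pm_id)
}.

HB.instance Definition _ := [isSub for GA_pair].
HB.instance Definition _ := [Choice of GA by <:].

Definition GA_map (F : GA) : polymap := (GA_pair F).1.
Definition GA_inverse_map (F : GA) : polymap := (GA_pair F).2.
Coercion GA_map : GA >-> polymap.

Lemma GA_mapK (F : GA) : pm_comp (GA_map F) (GA_inverse_map F) = pm_id.
Proof. by have /andP[/eqP] := valP F. Qed.

Lemma GA_inverse_mapK (F : GA) : pm_comp (GA_inverse_map F) (GA_map F) = pm_id.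
Proof. by have /andP[_ /eqP] := valP F. Qed.

Lemma GA_inj : injective GA_map.
Proof.
move=> F G eqFG; apply: val_inj; rewrite /= [GA_pair F]surjective_pairing.
rewrite [GA_pair G]surjective_pairing; congr (_, _) => //.
rewrite -/(GA_inverse_map F) -/(GA_inverse_map G).
rewrite -[LHS]pm_comp1 -(GA_mapK G) -eqFG pm_compA.
by rewrite GA_inverse_mapK pm_1comp.
Qed.

Lemma GA_intro (F G : polymap) :
  pm_comp F G = pm_id -> pm_comp G F = pm_id -> exists H : GA, GA_map H = F.
Proof.
move=> FG GF.
suff FGP : (pm_comp F G == pm_id) && (pm_comp G F == pm_id).
  by exists (@MkGA (F, G) FGP).
by rewrite FG GF eqxx.
Qed.

Fact GA_one_subproof :
  (pm_comp pm_id pm_id == pm_id) && (pm_comp pm_id pm_id == pm_id).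
Proof. by rewrite pm_comp1 eqxx. Qed.
Definition GA_one : GA := @MkGA (pm_id, pm_id) GA_one_subproof.

Fact GA_inv_subproof (F : GA) :
  (pm_comp (GA_inverse_map F) F == pm_id)
  && (pm_comp F (GA_inverse_map F) == pm_id).
Proof. by rewrite GA_mapK GA_inverse_mapK eqxx. Qed.
Definition GA_inv (F : GA) : GA :=
  @MkGA (GA_inverse_map F, GA_map F) (GA_inv_subproof F).

Fact GA_mul_subproof (F G : GA) :
  let H := pm_comp F G in
  let H' := pm_comp (GA_inverse_map G) (GA_inverse_map F) in
  (pm_comp H H' == pm_id) && (pm_comp H' H == pm_id).
Proof.
rewrite /= -pm_compA [pm_comp G _]pm_compA GA_mapK pm_1comp GA_mapK.
rewrite -pm_compA [pm_comp (GA_inverse_map F) _]pm_compA GA_inverse_mapK.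
by rewrite pm_1comp GA_inverse_mapK !eqxx.
Qed.
Definition GA_mul (F G : GA) : GA :=
  @MkGA (pm_comp F G, pm_comp (GA_inverse_map G) (GA_inverse_map F))
    (GA_mul_subproof F G).

Fact GA_mulA : associative GA_mul.
Proof. by move=> F G H; apply: GA_inj; apply: pm_compA. Qed.

Fact GA_1mul : left_id GA_one GA_mul.
Proof. by move=> F; apply: GA_inj; apply: pm_1comp. Qed.

Fact GA_mul1 : right_id GA_one GA_mul.
Proof. by move=> F; apply: GA_inj; apply: pm_comp1. Qed.

Fact GA_mulVl : left_inverse GA_one GA_inv GA_mul.
Proof. by move=> F; apply: GA_inj; apply: GA_inverse_mapK. Qed.

Fact GA_mulVr : right_inverse GA_one GA_inv GA_mul.
Proof. by move=> F; apply: GA_inj; apply: GA_mapK. Qed.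

HB.instance Definition _ :=
  isGroup.Build GA GA_mulA GA_1mul GA_mul1 GA_mulVl GA_mulVr.

End PolynomialMaps.

(* Main.v *)
Require Import Defs.
From HB Require Import structures.
From mathcomp Require Import all_boot all_algebra.
From mathcomp Require Import mpoly.

(** Write D for Delta_F, so that sigma_F = 1 + D and, the images of the
    variables determining a polynomial map, F ^ m is the identity exactly when
    sigma_F ^ m fixes every 'X_i ([expGA_eq1]).  As D is additive, sigma_F ^ m
    expands by the binomial formula; for m = p ^ e in characteristic p only
    the two extreme terms survive, so sigma_F ^ (p ^ e) = 1 + D ^ (p ^ e)
    ([iter_addl_pchar]).  Hence F ^ (p ^ e) = 1 if and only if D ^ (p ^ e)
    kills all the variables, that is, if and only if the Pascal depth t is at
    most p ^ e ([expGA_pX_eq1]).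

    Taking for e the least exponent with t <= p ^ e gives F ^ (p ^ e) = 1.
    Conversely, if F ^ k = 1 with k > 0, then F ^ (gcd (k, p ^ e)) = 1 too
    ([expg_gcdn]).  This gcd is some p ^ j, so t <= p ^ j, whence e <= j by the
    choice of e, and p ^ e <= p ^ j <= k. *)

Set Implicit Arguments.
Unset Strict Implicit.
Unset Printing Implicit Defensive.

Import GRing.Theory.

(** Only the comparisons of the Pascal depth with finite values matter; through
    them the minimum and the maximum in its definition become conditions on
    the individual iterates of Delta_F. *)
Definition ele (a : enat) (m : nat) : bool :=
  if a is Some x then x <= m else false.

Lemma ele_emax a b m : ele (emax a b) m = ele a m && ele b m.
Proof. by case: a b => [x|] [y|] //=; rewrite ?geq_max ?andbF. Qed.

Lemma ele_bigmax (I : finType) (a : I -> enat) m :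
  ele (\big[emax/Some 0]_i a i) m = [forall i, ele (a i) m].
Proof.
rewrite (big_morph (ele^~ m) (fun x y => ele_emax x y m) (id2 := Some 0) erefl).
by rewrite big_andE.
Qed.

Lemma ele_least_pos (P : pred nat) m :
    (forall j k, j <= k -> P j -> P k) -> 0 < m ->
  ele (least_pos P) m = P m.
Proof.
move=> Pmono m_gt0; case defd: (least_pos P) => [d|] /=.
  have [_ Pd dmin] := (least_posP P d).1 defd.
  by apply/idP/idP => [/Pmono|]; [apply | apply: dmin].
by rewrite (negbTE ((least_pos_None P).1 defd m m_gt0)).
Qed.

Lemma expg_gcdn (G : groupType) (x : G) (a b : nat) : 0 < a ->
  (x ^+ a = 1 -> x ^+ b = 1 -> x ^+ gcdn a b = 1)%g.
Proof.
move=> a_gt0 xa xb; have [c _ /dvdnP[q defq]] := Bezoutl b a_gt0.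
have := congr1 (fun k => x ^+ k)%g defq.
by rewrite expgnDr (mulnC c) (mulnC q) !expgnA xa xb !expg1n mulg1.
Qed.

(** If p did not divide 'C(p ^ e, k), it would be coprime to it, and then
    k * 'C(p ^ e, k) = p ^ e * 'C(p ^ e - 1, k - 1) would force p ^ e to
    divide k. *)
Lemma prime_dvd_bin_pX p e k :
  prime p -> 0 < k < p ^ e -> p %| 'C(p ^ e, k).
Proof.
case: k => // k p_pr /= lt_k; apply: contraLR lt_k.
rewrite -prime_coprime // -leqNgt => co_pC; apply: dvdn_leq => //.
rewrite -(@Gauss_dvdl _ _ 'C(p ^ e, k.+1)) ?coprimeXl //.
by rewrite -mul_bin_diag dvdn_mulr.
Qed.

Local Open Scope ring_scope.

Section IterAdd.
Variables (V : zmodType) (f : {additive V -> V}).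

Lemma iter_addl_bin m v :
  iter m (fun x => f x + x) v = \sum_(k < m.+1) iter k f v *+ 'C(m, k).
Proof.
elim: m => [|m IHm]; first by rewrite big_ord_recl big_ord0 addr0.
rewrite iterS IHm raddf_sum [RHS]big_ord_recl /=.
rewrite [X in _ = _ + X](eq_bigr (fun k : 'I_m.+1 =>
  iter k.+1 f v *+ 'C(m, k.+1) + iter k.+1 f v *+ 'C(m, k))); last first.
  by move=> k _; rewrite -mulrnDr -binS.
rewrite big_split /= addrA addrC; congr (_ + _).
  by apply: eq_bigr => k _; rewrite raddfMn.
rewrite [LHS]big_ord_recl [X in _ = _ + X]big_ord_recr /=.
by rewrite (bin_small (leqnn _)) addr0 !bin0.
Qed.

(** In the binomial expansion of (f + 1) ^ (p ^ e) the coefficients other than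
    the first and the last are multiples of p. *)
Lemma iter_addl_pchar p e v : prime p -> (forall x : V, x *+ p = 0) ->
  iter (p ^ e) (fun x => f x + x) v = iter (p ^ e) f v + v.
Proof.
move=> p_pr Vp0; rewrite iter_addl_bin.
have pe_gt0 : (0 < p ^ e)%N by rewrite expn_gt0 prime_gt0.
rewrite big_ord_recr /= binn addrC; congr (_ + _).
case: (p ^ e)%N pe_gt0 (@prime_dvd_bin_pX p e) => // q _ p_dvd.
rewrite big_ord_recl big1 ?addr0 // => k _.
have /dvdnP[c ->] : (p %| 'C(q.+1, k.+1))%N by rewrite p_dvd //= ltnS.
by rewrite mulnC mulrnA Vp0 mul0rn.
Qed.

Lemma iter_additive_eq0_le j k v : (j <= k)%N ->
  iter j f v = 0 -> iter k f v = 0.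
Proof.
by move=> /subnK<- fj0; rewrite iterD fj0; elim: (k - j)%N => //= i ->; rewrite raddf0.
Qed.

End IterAdd.

Section PascalDepth.
Variables (K : fieldType) (n : nat).

Lemma pm_Delta_is_zmod_morphism (F : polymap K n) :
  zmod_morphism (pm_Delta F).
Proof. by move=> P Q; rewrite /pm_Delta /pm_sigma raddfB /= !opprD addrACA. Qed.

HB.instance Definition _ (F : polymap K n) :=
  GRing.isZmodMorphism.Build {mpoly K[n]} {mpoly K[n]} (pm_Delta F)
    (pm_Delta_is_zmod_morphism F).

(** The iterates of Delta_F on a variable stay zero once they vanish, so a bound
    on the first exponent where this happens is a single equation.  The case
    m = 0 is excluded because Pascal depths of polynomials start at 1. *)
Lemma ele_pascal_depth (F : polymap K n) m : (0 < m)%N ->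
  ele (pascal_depth F) m = [forall i : 'I_n, iter m (pm_Delta F) 'X_i == 0].
Proof.
move=> m_gt0; rewrite ele_bigmax; apply: eq_forallb => i.
rewrite [LHS]ele_least_pos // => j k le_jk /eqP Dj0.
by rewrite (iter_additive_eq0_le le_jk Dj0).
Qed.

(** Composition with F on the right is sigma_F on each coordinate, hence the
    choice of F ^ (m + 1) = F ^ m * F for the induction. *)
Lemma tnth_expGA (F : GA K n) m i :
  tnth (GA_map (F ^+ m)%g) i = iter m (pm_sigma F) 'X_i.
Proof.
elim: m => [|m IHm]; first by rewrite expg0 tnth_mktuple.
by rewrite expgSr /= tnth_mktuple IHm.
Qed.

Lemma expGA_eq1 (F : GA K n) m :
  ((F ^+ m)%g == 1%g) = [forall i : 'I_n, iter m (pm_sigma F) 'X_i == 'X_i].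
Proof.
apply/eqP/forallP => [Fm1 i|fix_X].
  by rewrite -tnth_expGA Fm1 tnth_mktuple.
apply: GA_inj; apply: eq_from_tnth => i.
by rewrite tnth_expGA tnth_mktuple; apply/eqP.
Qed.

(** Since sigma_F ^ (p ^ e) = 1 + Delta_F ^ (p ^ e), a variable is fixed by
    the former exactly when it is killed by Delta_F ^ (p ^ e). *)
Lemma expGA_pX_eq1 p (charK : p \in [pchar K]) (F : GA K n) e :
  ((F ^+ (p ^ e))%g == 1%g) = ele (pascal_depth F) (p ^ e).
Proof.
have p_pr := pcharf_prime charK.
rewrite expGA_eq1 ele_pascal_depth ?expn_gt0 ?prime_gt0 //.
apply: eq_forallb => i.
have /eq_iter -> : pm_sigma F =1 (fun P => pm_Delta F P + P).
  by move=> P; rewrite subrK.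
have mpoly_p0 (P : {mpoly K[n]}) : P *+ p = 0.
  by rewrite -scaler_nat (pcharf0 charK) scale0r.
by rewrite (iter_addl_pchar (pm_Delta F) _ _ p_pr mpoly_p0) -subr_eq0 addrK.
Qed.

End PascalDepth.

Local Close Scope ring_scope.

Theorem lemma3p1 (K : fieldType) (p : nat) (charK : p \in [pchar K]%R)
    (n : nat) (n_gt0 : 0 < n) (F : GA K n) (finF : pascal_finite F) :
  (exists2 t : nat, pascal_depth F = Some t &
     group_order F = Some (p ^ up_log p t))
  /\ (exists e : nat, group_order F = Some (p ^ e)).
Proof.
have p_pr := pcharf_prime charK; have p_gt1 := prime_gt1 p_pr.
suff [t dF oF] : exists2 t, pascal_depth F = Some t &
    group_order F = Some (p ^ up_log p t).
  by split; [exists t | exists (up_log p t)].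
case dF: (pascal_depth F) finF => [t|]; last by rewrite /pascal_finite dF.
move=> _; exists t => //; have eX1 := expGA_pX_eq1 charK F.
rewrite dF /= in eX1.
have FX1 : (F ^+ (p ^ up_log p t) = 1)%g by apply/eqP; rewrite eX1 up_logP.
have pe_gt0 : 0 < p ^ up_log p t by rewrite expn_gt0 prime_gt0.
apply/least_posP; split=> [//||k k_gt0 /eqP Fk1]; first exact/eqP.
have /eqP := expg_gcdn k_gt0 Fk1 FX1.
have /(dvdn_pfactor _ _ p_pr)[j _ defj] := dvdn_gcdr k (p ^ up_log p t).
rewrite defj eX1 => /(up_log_min p_gt1) le_ej.
apply: (leq_trans (leq_pexp2l (ltnW p_gt1) le_ej)).
by rewrite -defj dvdn_leq ?dvdn_gcdl.
Qed.
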